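(* There exists a two-dimensional complex Banach space $E$ such that the completed injective tensor product $L_1^{\mathbb{C}}[0,1]\widehat{\otimes}_{\varepsilon}E$ fails the Daugavet property, where $L_1^{\mathbb{C}}[0,1]$ denotes the space of complex-valued $L_1$-functions on $[0,1]$ (with Lebesgue measure).
   Context: A (complex) Banach space $W$ has the Daugavet property if $\|\mathrm{Id}+T\|=1+\|T\|$ for every bounded ($\mathbb{C}$-linear) rank-1 operator $T\colon W\to W$. $\widehat{\otimes}_{\varepsilon}$ denotes the completed injective tensor product of complex Banach spaces. *)

(* Defs.v *)
From HB Require Import structures.
From mathcomp Require Import all_boot all_order all_algebra ring_quotient generic_quotient.
From mathcomp Require Import complex lra.
From mathcomp Require Import all_classical all_reals all_analysis.
Set Implicit Arguments.
Unset Strict Implicit.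
Unset Printing Implicit Defensive.
Import Order.TTheory GRing.Theory Num.Theory.
Import numFieldNormedType.Exports measurable_realfun.
Local Open Scope classical_set_scope.
Local Open Scope ring_scope.
Local Open Scope complex_scope.

(* MathComp-Analysis equips K^o with its normed-module structure for any
   numFieldType K, but does not transport it to the concrete type R[i]. *)
HB.instance Definition _ (R : realType) := PseudoPointedMetric.copy R[i] R[i]^o.
HB.instance Definition _ (R : realType) := GRing.ComAlgebra.copy R[i] R[i]^o.
HB.instance Definition _ (R : realType) := Vector.copy R[i] R[i]^o.
HB.instance Definition _ (R : realType) := NormedModule.copy R[i] R[i]^o.
HB.instance Definition _ (R : realType) := Num.ClosedField.on R[i].

Section rnorm.
Variables (R : realType) (V : normedModType R[i]).
Implicit Types x y : V.

(* Over R[i] the norm of the library takes its values in R[i]; rnorm is the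
   same norm read in R (see rnormE). *)
Definition rnorm x : R := complex.Re `|x|.

Lemma rnormE x : (rnorm x)%:C = `|x|.
Proof. by rewrite /rnorm RRe_real. Qed.

Lemma rnorm_ge0 x : 0 <= rnorm x.
Proof. by rewrite -lecR rnormE normr_ge0. Qed.

Lemma rnormD x y : rnorm (x + y) <= rnorm x + rnorm y.
Proof. by rewrite -lecR rmorphD /= !rnormE ler_normD. Qed.

Lemma rnorm0_eq0 x : rnorm x = 0 -> x = 0.
Proof. by move=> x0; apply/normr0_eq0; rewrite -rnormE x0. Qed.

End rnorm.

Section rnorm_complex.
Variable R : realType.
Implicit Types z : R[i].

Lemma rnormc_sqrt z : rnorm z = Num.sqrt (complex.Re z ^+ 2 + complex.Im z ^+ 2).
Proof. by rewrite /rnorm normc_def. Qed.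

Lemma rnormcZ (V : normedModType R[i]) (c : R[i]) (x : V) :
  rnorm (c *: x) = rnorm c * rnorm x.
Proof. by apply: complexI; rewrite rmorphM /= !rnormE normrZ. Qed.

Lemma ler_Re_rnorm z : `|complex.Re z| <= rnorm z.
Proof. by rewrite rnormc_sqrt -sqrtr_sqr ler_sqrt ?lerDl ?addr_ge0 ?sqr_ge0. Qed.

Lemma ler_Im_rnorm z : `|complex.Im z| <= rnorm z.
Proof. by rewrite rnormc_sqrt -sqrtr_sqr ler_sqrt ?lerDr ?addr_ge0 ?sqr_ge0. Qed.

Lemma rnorm_le_ReIm z : rnorm z <= `|complex.Re z| + `|complex.Im z|.
Proof.
rewrite rnormc_sqrt -[leRHS]ger0_norm ?addr_ge0// -sqrtr_sqr ler_sqrt ?sqr_ge0//.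
by rewrite sqrrD !real_normK ?num_real// -addrA lerD2l lerDr mulrn_wge0// mulr_ge0.
Qed.

End rnorm_complex.

Section L1.
Variable R : realType.
Local Notation I01 := (`[0%R, 1%R]%classic : set (measurableTypeR R)).
Local Notation mu := (@lebesgue_measure R).

Let mI : measurable I01. Proof. exact: measurable_itv. Qed.

(* Measurability on [0, 1] is part of mu.-integrable. *)
Definition integrableC (f : R -> R[i]) : Prop :=
  mu.-integrable I01 (EFin \o (fun t => complex.Re (f t))) /\
  mu.-integrable I01 (EFin \o (fun t => complex.Im (f t))).

Definition L1_pred : {pred R -> R[i]} := fun f => `[< integrableC f >].

Lemma L1_pred_submod : submod_closed L1_pred.
Proof.
split.
  by apply/asboolP; split; exact: integrable0.
move=> c f g /asboolP[f1 f2] /asboolP[g1 g2]; apply/asboolP; split.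
  have -> : EFin \o (fun t => complex.Re ((c *: f + g) t)) =
    (((fun t => (complex.Re c)%:E * (complex.Re (f t))%:E) \-
     (fun t => (complex.Im c)%:E * (complex.Im (f t))%:E)) \+
     (EFin \o (fun t => complex.Re (g t))))%E.
    apply/funext => t /=; rewrite !fctE /=.
    rewrite -!EFinM -EFinB -EFinD; congr EFin.
    by case: c (f t) (g t) => [a b] [x y] [u v].
  apply: integrableD => //; apply: integrableB => //; exact: integrableZl.
have -> : EFin \o (fun t => complex.Im ((c *: f + g) t)) =
    (((fun t => (complex.Re c)%:E * (complex.Im (f t))%:E) \+
     (fun t => (complex.Im c)%:E * (complex.Re (f t))%:E)) \+
     (EFin \o (fun t => complex.Im (g t))))%E.
  apply/funext => t /=; rewrite !fctE /=.
  rewrite -!EFinM -!EFinD; congr EFin.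
  by case: c (f t) (g t) => [a b] [x y] [u v].
apply: integrableD => //; apply: integrableD => //; exact: integrableZl.
Qed.

HB.instance Definition _ := GRing.isSubmodClosed.Build _ _ L1_pred L1_pred_submod.

Record L1fun := L1Fun { L1fun_val :> R -> R[i] ; _ : L1fun_val \in L1_pred }.
HB.instance Definition _ := [isSub for L1fun_val].
HB.instance Definition _ := [Choice of L1fun by <:].
HB.instance Definition _ := [SubChoice_isSubLmodule of L1fun by <:].

Lemma L1funP (f : L1fun) : integrableC f.
Proof. exact/asboolP/(valP f). Qed.

Definition ae_null (f : L1fun) : Prop := {ae mu, forall t, I01 t -> f t = 0}.

Definition ae_null_pred : {pred L1fun} := fun f => `[< ae_null f >].

Lemma ae_nullZ c f : ae_null f -> ae_null (c *: f).
Proof. by apply: filterS => t ft It; rewrite -[LHS]/(c *: f t) ft// scaler0. Qed.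

Lemma ae_null_zmod : zmod_closed ae_null_pred.
Proof.
split; first by apply/asboolP; apply/aeW.
move=> f g /asboolP f0 /asboolP g0; apply/asboolP.
rewrite /ae_null; near=> t => It.
have -> : (f - g) t = f t - g t by [].
rewrite (near f0 t)// (near g0 t)// ?subr0//.
Unshelve. all: by end_near. Qed.

HB.instance Definition _ := GRing.isZmodClosed.Build _ ae_null_pred ae_null_zmod.

(* Integrable functions on [0, 1] modulo equality almost everywhere on [0, 1];
   the values outside [0, 1] are irrelevant (see L1classP). *)
Definition L1 : Type := {ideal_quot ae_null_pred}.
HB.instance Definition _ := GRing.Zmodule.on L1.

Definition L1class (f : L1fun) : L1 := \pi_{ideal_quot ae_null_pred}%qT f.
HB.instance Definition _ := GRing.Additive.copy L1class (\pi_{ideal_quot ae_null_pred}%qT : L1fun -> L1).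
Definition L1repr (f : L1) : L1fun := repr (f : {ideal_quot ae_null_pred}).
Lemma L1reprK f : L1class (L1repr f) = f. Proof. exact: reprK. Qed.

Lemma L1classP (f g : L1fun) :
  L1class f = L1class g <-> {ae mu, forall t, I01 t -> f t = g t}.
Proof.
have -> : {ae mu, forall t, I01 t -> f t = g t} <-> f - g \in ae_null_pred.
  split => [fg|/asboolP].
    by apply/asboolP; apply: filterS fg => t fg It;
      rewrite -[LHS]/(f t - g t) fg// subrr.
  by apply: filterS => t fg /fg /eqP; rewrite subr_eq0 => /eqP.
rewrite Quotient.idealrBE; split => [fg|/eqP//]; exact/eqP.
Qed.

Definition L1scale (c : R[i]) (x : L1) : L1 := L1class (c *: L1repr x).

Lemma L1scaleE c (f : L1fun) : L1scale c (L1class f) = L1class (c *: f).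
Proof.
apply/L1classP; have /L1classP := L1reprK (L1class f).
by apply: filterS => t ft It; rewrite -[LHS]/(c *: L1repr _ t) ft.
Qed.

Lemma L1ind (P : L1 -> Prop) : (forall f, P (L1class f)) -> forall x, P x.
Proof. by move=> Pf x; rewrite -(L1reprK x). Qed.

Let L1scaleA a b x : L1scale a (L1scale b x) = L1scale (a * b) x.
Proof. by elim/L1ind: x => f; rewrite !L1scaleE scalerA. Qed.
Let L1scale1 : left_id 1 L1scale.
Proof. by elim/L1ind => f; rewrite !L1scaleE scale1r. Qed.
Let L1scaleDr : right_distributive L1scale +%R.
Proof.
move=> a; elim/L1ind => f; elim/L1ind => g.
by rewrite -raddfD !L1scaleE scalerDr raddfD.
Qed.
Let L1scaleDl x : {morph L1scale^~ x : a b / a + b}.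
Proof. by elim/L1ind: x => f a b; rewrite !L1scaleE scalerDl raddfD. Qed.

HB.instance Definition _ := GRing.Zmodule_isLmodule.Build R[i] L1
  L1scaleA L1scale1 L1scaleDr L1scaleDl.

Lemma L1class_linear : linear L1class.
Proof. by move=> c f g; rewrite raddfD /= -L1scaleE. Qed.

Lemma measurable_rnorm_L1 (f : L1fun) : measurable_fun I01 (fun t => rnorm (f t)).
Proof.
have [/measurable_int/measurable_EFinP f1 /measurable_int/measurable_EFinP f2] := L1funP f.
rewrite (_ : (fun _ => _) = fun t =>
  Num.sqrt (complex.Re (f t) ^+ 2 + complex.Im (f t) ^+ 2)); last first.
  by apply/funext => t; exact: rnormc_sqrt.
have ms : measurable_fun setT (@Num.sqrt R : measurableTypeR R -> measurableTypeR R).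
  by apply: continuous_measurable_fun; exact: sqrt_continuous.
exact: (measurableT_comp ms (measurable_realfun.measurable_funD
  (measurable_funX 2 f1) (measurable_funX 2 f2))).
Qed.

Lemma integrable_rnorm_L1 (f : L1fun) :
  mu.-integrable I01 (EFin \o (fun t => rnorm (f t))).
Proof.
have [f1 f2] := L1funP f.
have gi : mu.-integrable I01 ((abse \o (EFin \o (fun t => complex.Re (f t)))) \+
   (abse \o (EFin \o (fun t => complex.Im (f t)))))%E.
  by apply: integrableD => //; exact: integrable_abse.
apply: (le_integrable mI _ _ gi).
  by apply/measurable_EFinP; exact: measurable_rnorm_L1.
move=> t _ /=; rewrite lee_fin ger0_norm ?rnorm_ge0//.
by rewrite ger0_norm ?addr_ge0// rnorm_le_ReIm.
Qed.

Definition L1norm (x : L1) : R := \int[mu]_(t in I01) rnorm (L1repr x t).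

Lemma L1normE (f : L1fun) : L1norm (L1class f) = \int[mu]_(t in I01) rnorm (f t).
Proof.
rewrite /L1norm /Rintegral; congr fine; apply: ae_eq_integral => //.
- by apply/measurable_EFinP; exact: measurable_rnorm_L1.
- by apply/measurable_EFinP; exact: measurable_rnorm_L1.
have /L1classP := L1reprK (L1class f).
by apply: filterS => t ft It; rewrite ft.
Qed.

Let L1normD x y : (L1norm (x + y))%:C <= (L1norm x)%:C + (L1norm y)%:C.
Proof.
elim/L1ind: x => f; elim/L1ind: y => g.
rewrite -raddfD !L1normE -rmorphD lecR -RintegralD//; last 2 first.
- exact: integrable_rnorm_L1.
- exact: integrable_rnorm_L1.
apply: le_Rintegral => //.
- exact: integrable_rnorm_L1.
- have := integrableD mI (integrable_rnorm_L1 f) (integrable_rnorm_L1 g).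
  by [].
- by move=> t _; exact: rnormD.
Qed.

Let L1normZ (c : R[i]) x : (L1norm (c *: x))%:C = `|c| * (L1norm x)%:C.
Proof.
elim/L1ind: x => f.
rewrite -[c *: _]/(L1scale c _) L1scaleE !L1normE -(rnormE (c : R[i])) -rmorphM.
rewrite -RintegralZl//; last exact: integrable_rnorm_L1.
by congr (_%:C); apply: eq_Rintegral => t _; exact: rnormcZ.
Qed.

Let L1norm0 x : (L1norm x)%:C = 0 -> x = 0.
Proof.
elim/L1ind: x => f /complexI; rewrite L1normE => f0.
rewrite -(raddf0 L1class); apply/L1classP.
have mf : measurable_fun I01 (EFin \o (fun t => rnorm (f t))).
  by apply/measurable_EFinP; exact: measurable_rnorm_L1.
have /(ae_eq_integral_abs mu mI mf) : (\int[mu]_(t in I01) `|(EFin \o (fun t => rnorm (f t))) t|)%E = 0%E.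
  under eq_integral do rewrite /= ger0_norm ?rnorm_ge0//.
  have := integrable_fin_num mI (integrable_rnorm_L1 f).
  by move=> /fineK <-; rewrite -[fine _]/(Rintegral _ _ _) f0.
by apply: filterS => t /[apply] /= -[] /rnorm0_eq0.
Qed.

HB.instance Definition _ := Lmodule_isNormed.Build R[i] L1 L1normD L1normZ L1norm0.

Lemma L1_normE (x : L1) : `|x| = (L1norm x)%:C.
Proof. by []. Qed.

End L1.

Section complete_aux.
Variables (R : realType) (V : normedModType R[i]).

Let pos_complex (e : R[i]) : 0 < e -> 0 < complex.Re e /\ (complex.Re e)%:C = e.
Proof.
case: e => a b; rewrite ltcE /= => /andP[/eqP -> a0]; split => //.
Qed.

Lemma rnorm_cauchyP (F : set_system V) : ProperFilter F ->
  cauchy F <-> forall e : R, 0 < e ->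
    exists u, F [set v | rnorm (u - v) < e].
Proof.
move=> FF; split=> [/cauchyP Fc e e0|Fc].
  have [] := Fc e%:C; first by rewrite ltcR.
  move=> u Fu; exists u; apply: filterS Fu => v.
  by rewrite -ball_normE /ball_ /= -rnormE ltcR.
apply/cauchyP => e /pos_complex[e0 eE].
have [u Fu] := Fc _ e0; exists u; apply: filterS Fu => v /= uv.
by rewrite -ball_normE /ball_ /= -rnormE -eE ltcR.
Qed.

Lemma rnorm_cvgP (F : set_system V) (l : V) : Filter F ->
  F --> l <-> forall e : R, 0 < e -> F [set v | rnorm (l - v) < e].
Proof.
move=> FF; split=> [/cvgrPdist_lt Fl e e0|Fl].
  have := Fl e%:C; rewrite ltcR => /(_ e0).
  by apply: filterS => v; rewrite -rnormE ltcR.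
apply/cvgrPdist_lt => e /pos_complex[e0 <-].
by apply: filterS (Fl _ e0) => v /=; rewrite -rnormE ltcR.
Qed.

End complete_aux.

Section complex_complete.
Variable R : realType.

Lemma complex_complete (F : set_system R[i]) : ProperFilter F ->
  cauchy F -> cvg F.
Proof.
move=> FF /rnorm_cauchyP Fc.
have cR (g : R[i] -> R) : (forall x y, `|g x - g y| <= rnorm (x - y)) ->
    cvg (g @ F).
  move=> gl; apply: cauchy_cvg; apply/cauchyP => e e0.
  have [u Fu] := Fc _ e0; exists (g u).
  suff : F (g @^-1` ball (g u) e) by [].
  apply: filterS Fu => v /= uv.
  by rewrite -ball_normE /ball_ /=; exact: (le_lt_trans (gl u v) uv).
have cRe : cvg ((@complex.Re R : R[i] -> R) @ F).
  by apply: cR => -[a b] [c d]; exact: (ler_Re_rnorm ((a +i* b) - (c +i* d))).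
have cIm : cvg ((@complex.Im R : R[i] -> R) @ F).
  by apply: cR => -[a b] [c d]; exact: (ler_Im_rnorm ((a +i* b) - (c +i* d))).
apply/cvg_ex; exists (lim ((@complex.Re R : R[i] -> R) @ F) +i*
  lim ((@complex.Im R : R[i] -> R) @ F)).
apply/rnorm_cvgP => e e0.
have e20 : 0 < e / 2 by rewrite divr_gt0.
have /cvgrPdist_lt/(_ _ e20) Fr := cRe.
have /cvgrPdist_lt/(_ _ e20) Fi := cIm.
apply: filterS2 Fr Fi => -[a b] /= ha hb.
apply: le_lt_trans (rnorm_le_ReIm _) _.
by rewrite [ltRHS](splitr e) ltrD.
Qed.

HB.instance Definition _ := Uniform_isComplete.Build R[i] complex_complete.

End complex_complete.

(* The closed unit ball of the dual of X. *)
Record dual_ball (R : realType) (X : normedModType R[i]) := DualBall {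
  dual_ball_fun :> {linear X -> R[i]} ;
  dual_ballP : forall x, `|dual_ball_fun x| <= `|x| }.

Section injective_tensor.
Variables (R : realType) (X Y : normedModType R[i]).
Local Notation K := (dual_ball X * dual_ball Y)%type.

(* The finite sum of the x (x) y, seen as the function
   (f, g) |-> \sum f x * g y on the product of the dual unit balls. The injective
   norm of this tensor is by definition the sup norm of that function. *)
Definition elem_tensors (s : seq (X * Y)) : K -> R[i] :=
  fun p => \sum_(xy <- s) p.1 xy.1 * p.2 xy.2.

(* The completed injective tensor product is realised as the closure, for the
   sup norm, of the algebraic tensor product in the Banach space of bounded
   functions on the product of the dual unit balls. The instances and the lemmas
   tensor_linearl, tensor_linearr, sum_tensor_norm and sum_tensor_dense below show
   that it is a Banach space, spanned densely by the range of a bilinear map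
   `tensor' for which a finite sum of tensors has its injective norm. Completeness
   of X and Y is not needed for the construction. *)
Definition inj_tensor_pred : {pred K -> R[i]} := fun u =>
  `[< forall e : R, 0 < e -> exists s, forall p, rnorm (u p - elem_tensors s p) <= e >].

Lemma elem_tensors_cat s t p :
  elem_tensors (s ++ t) p = elem_tensors s p + elem_tensors t p.
Proof. by rewrite /elem_tensors big_cat. Qed.

Lemma elem_tensors_scale c s p :
  elem_tensors [seq (c *: xy.1, xy.2) | xy <- s] p = c * elem_tensors s p.
Proof.
rewrite /elem_tensors big_map mulr_sumr; apply: eq_bigr => xy _ /=.
by rewrite linearZ /= mulrA.
Qed.

Lemma inj_tensor_submod : submod_closed inj_tensor_pred.
Proof.
split.
  apply/asboolP => e e0; exists [::] => p.
  by rewrite /elem_tensors big_nil subr0 /rnorm normr0 /= ltW.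
move=> c u v /asboolP hu /asboolP hv; apply/asboolP => e e0.
have c1 : 0 < rnorm (c : R[i]) + 1 by rewrite ltr_wpDl ?rnorm_ge0.
have [|s hs] := hu (e / 2 / (rnorm (c : R[i]) + 1)).
  by rewrite !divr_gt0.
have [|t ht] := hv (e / 2); first by rewrite divr_gt0.
exists ([seq (c *: xy.1, xy.2) | xy <- s] ++ t) => p.
rewrite elem_tensors_cat elem_tensors_scale.
rewrite -[(c *: u + v) p]/(c * u p + v p) opprD addrACA -mulrBr.
apply: le_trans (rnormD _ _) _.
rewrite [leRHS](splitr e) lerD// (rnormcZ c (u p - elem_tensors s p)).
apply: le_trans (ler_wpM2l (rnorm_ge0 _) (hs p)) _.
by rewrite mulrA ler_pdivrMr// mulrC ler_wpM2l ?lerDl// ltW// divr_gt0.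
Qed.

HB.instance Definition _ :=
  GRing.isSubmodClosed.Build _ _ inj_tensor_pred inj_tensor_submod.

Record inj_tensor := InjTensor {
  inj_tensor_val :> K -> R[i] ; _ : inj_tensor_val \in inj_tensor_pred }.
HB.instance Definition _ := [isSub for inj_tensor_val].
HB.instance Definition _ := [Choice of inj_tensor by <:].
HB.instance Definition _ := [SubChoice_isSubLmodule of inj_tensor by <:].

Definition inj_norm (u : inj_tensor) : R := sup (range (fun p => rnorm (u p))).

Let dual0 (Z : normedModType R[i]) : dual_ball Z.
Proof.
exists (\0 : {linear Z -> R[i]}) => x.
by rewrite /= normr0.
Defined.

Lemma elem_tensors_bound s :
  exists M : R, forall p, rnorm (elem_tensors s p) <= M.
Proof.
exists (\sum_(xy <- s) rnorm xy.1 * rnorm xy.2) => p.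
rewrite /elem_tensors; elim: s => [|xy s IH].
  by rewrite !big_nil /rnorm normr0.
rewrite !big_cons; apply: le_trans (rnormD _ _) _; rewrite lerD//.
rewrite (rnormcZ (p.1 xy.1) (p.2 xy.2 : R[i])) ler_pM ?rnorm_ge0//.
  by rewrite -lecR !rnormE dual_ballP.
by rewrite -lecR !rnormE dual_ballP.
Qed.

Lemma inj_tensor_has_sup (u : inj_tensor) :
  has_sup (range (fun p => rnorm (u p))).
Proof.
split; first by exists (rnorm (u (dual0 X, dual0 Y))), (dual0 X, dual0 Y).
have /asboolP/(_ 1 ltr01)[s hs] := valP u.
have [M hM] := elem_tensors_bound s.
exists (1 + M) => _ [p _ <-].
rewrite -[u p](subrK (elem_tensors s p)).
by apply: le_trans (rnormD _ _) _; rewrite lerD.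
Qed.

Lemma le_inj_norm (u : inj_tensor) p : rnorm (u p) <= inj_norm u.
Proof.
by apply: sup_upper_bound; [exact: inj_tensor_has_sup|exists p].
Qed.

Lemma inj_norm_le (u : inj_tensor) M :
  (forall p, rnorm (u p) <= M) -> inj_norm u <= M.
Proof.
move=> uM; apply: ge_sup; first by have [] := inj_tensor_has_sup u.
by move=> _ [p _ <-].
Qed.

Let inj_normD u v : (inj_norm (u + v))%:C <= (inj_norm u)%:C + (inj_norm v)%:C.
Proof.
rewrite -rmorphD lecR; apply: inj_norm_le => p.
by apply: le_trans (rnormD _ _) _; rewrite lerD// le_inj_norm.
Qed.

Let inj_normZle c u : inj_norm (c *: u) <= rnorm (c : R[i]) * inj_norm u.
Proof.
apply: inj_norm_le => p; rewrite -[(c *: u) p]/(c *: u p) rnormcZ.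
by rewrite ler_wpM2l ?rnorm_ge0// le_inj_norm.
Qed.

Let inj_normZ (c : R[i]) u : (inj_norm (c *: u))%:C = `|c| * (inj_norm u)%:C.
Proof.
rewrite -(rnormE (c : R[i])) -rmorphM; congr (_%:C).
apply/eqP; rewrite eq_le inj_normZle /=.
have [->|c0] := eqVneq c 0.
  rewrite {1}/rnorm normr0 mul0r.
  exact: le_trans (rnorm_ge0 _) (le_inj_norm _ (dual0 X, dual0 Y)).
have nc : 0 < rnorm (c : R[i]) by rewrite -ltcR rnormE normr_gt0.
rewrite mulrC -ler_pdivlMr// mulrC.
rewrite -[in leLHS](scalerK c0 u); apply: le_trans (inj_normZle _ _) _.
rewrite ler_wpM2r//.
  exact: le_trans (rnorm_ge0 _) (le_inj_norm _ (dual0 X, dual0 Y)).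
by rewrite -lecR fmorphV /= !rnormE normfV.
Qed.

Let inj_norm0 u : (inj_norm u)%:C = 0 -> u = 0.
Proof.
move=> /complexI u0; apply: val_inj; apply/funext => p.
apply: rnorm0_eq0; apply/eqP; rewrite eq_le rnorm_ge0 andbT -[leRHS]u0.
exact: le_inj_norm.
Qed.

HB.instance Definition _ :=
  Lmodule_isNormed.Build R[i] inj_tensor inj_normD inj_normZ inj_norm0.

Lemma inj_tensor_normE (u : inj_tensor) : rnorm u = inj_norm u.
Proof. by []. Qed.

Lemma inj_tensor_complete (F : set_system inj_tensor) :
  ProperFilter F -> cauchy F -> cvg F.
Proof.
move=> FF /rnorm_cauchyP Fc.
have Fp p : cvg ((fun u : inj_tensor => u p : R[i]) @ F).
  apply: cauchy_cvg; apply/rnorm_cauchyP => e /Fc[u Fu].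
  exists (u p).
  suff : F ((fun u : inj_tensor => u p) @^-1` [set v | rnorm (u p - v) < e]) by [].
  apply: filterS Fu => v /= uv.
  exact: le_lt_trans (le_inj_norm (u - v) p) uv.
pose l p : R[i] := lim ((fun u : inj_tensor => u p : R[i]) @ F).
have Fl (e : R) (u : inj_tensor) : F [set v | rnorm (u - v) < e] ->
    forall p, rnorm (l p - u p) <= e.
  move=> Fu p; apply/ler_addgt0Pr => d d0.
  have /rnorm_cvgP/(_ _ d0) : (fun u : inj_tensor => u p : R[i]) @ F --> l p.
    exact: Fp.
  move=> Fd; have {Fd} : F ((fun u : inj_tensor => u p) @^-1` [set v | rnorm (l p - v) < d]) by [].
  move=> Fd; have [v [/= vu vl]] := filter_ex (filterI Fu Fd).
  have -> : l p - u p = - (u - v) p + (l p - v p).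
    by rewrite -[(u - v) p]/(u p - v p) opprB [RHS]addrC subrKA.
  apply: le_trans (rnormD _ _) _; rewrite lerD ?(ltW vl)//.
  rewrite /rnorm normrN; exact: le_trans (le_inj_norm (u - v) p) (ltW vu).
have lP : l \in inj_tensor_pred.
  apply/asboolP => e e0; have e20 : 0 < e / 2 by rewrite divr_gt0.
  have [u Fu] := Fc _ e20.
  have /asboolP/(_ _ e20)[s us] := valP u.
  exists s => p; rewrite -[l p](subrK (u p)) -addrA.
  apply: le_trans (rnormD _ _) _.
  by rewrite [leRHS](splitr e) lerD// (Fl _ u).
apply/cvg_ex; exists (InjTensor lP); apply/rnorm_cvgP => e e0.
have e20 : 0 < e / 3 by rewrite divr_gt0.
have [u Fu] := Fc _ e20.
apply: filterS (Fu) => v /= uv.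
rewrite -[InjTensor lP](subrK u) -addrA.
apply: le_lt_trans (rnormD _ _) _.
apply: (@le_lt_trans _ _ (e / 3 + e / 3)); last by lra.
rewrite lerD ?(ltW uv)//; apply: inj_norm_le => p; exact: Fl.
Qed.

HB.instance Definition _ := Uniform_isComplete.Build inj_tensor inj_tensor_complete.

Lemma elem_tensors_in s : elem_tensors s \in inj_tensor_pred.
Proof.
by apply/asboolP => e e0; exists s => p; rewrite subrr /rnorm normr0 ltW.
Qed.

Definition tensor (x : X) (y : Y) : inj_tensor :=
  InjTensor (elem_tensors_in [:: (x, y)]).

Lemma tensorE x y (p : K) : tensor x y p = p.1 x * p.2 y.
Proof. by rewrite /= /elem_tensors big_seq1. Qed.

Lemma tensor_linearl y : linear (tensor^~ y).
Proof.
move=> c x x'; apply: val_inj; apply/funext => p.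
rewrite -[RHS]/(c * tensor x y p + tensor x' y p) -[LHS]/(tensor _ _ p) !tensorE.
by rewrite linearP /= mulrDl mulrA.
Qed.

Lemma tensor_linearr x : linear (tensor x).
Proof.
move=> c y y'; apply: val_inj; apply/funext => p.
rewrite -[RHS]/(c * tensor x y p + tensor x y' p) -[LHS]/(tensor _ _ p) !tensorE.
by rewrite linearP /= mulrDr mulrCA.
Qed.

Lemma sum_tensorE (s : seq (X * Y)) (p : K) :
  (\sum_(xy <- s) tensor xy.1 xy.2 : inj_tensor) p = elem_tensors s p.
Proof.
elim: s => [|xy s IH]; first by rewrite /elem_tensors !big_nil.
rewrite big_cons /elem_tensors big_cons -[X in _ = _ + X]/(elem_tensors s p) -IH.
by rewrite -tensorE.
Qed.

Lemma sum_tensor_norm (s : seq (X * Y)) :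
  rnorm (\sum_(xy <- s) tensor xy.1 xy.2 : inj_tensor) =
  sup [set rnorm (\sum_(xy <- s) p.1 xy.1 * p.2 xy.2 : R[i]) | p in [set: K]].
Proof.
rewrite inj_tensor_normE; congr sup; apply: eq_imagel => p _.
by rewrite sum_tensorE.
Qed.

Lemma sum_tensor_dense (u : inj_tensor) (e : R) : 0 < e ->
  exists s : seq (X * Y), rnorm (u - \sum_(xy <- s) tensor xy.1 xy.2) <= e.
Proof.
have /asboolP uP := valP u.
move=> /uP[s us]; exists s; apply: inj_norm_le => p.
by rewrite -[X in rnorm X]/(u p - (\sum_(xy <- s) tensor xy.1 xy.2 : inj_tensor) p) sum_tensorE.
Qed.

End injective_tensor.

Section daugavet.
Variable R : realType.

Definition opnorm (V W : normedModType R[i]) (T : V -> W) : R :=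
  sup [set rnorm (T x) | x in [set x | `|x| <= 1]].

Definition bounded_op (V W : normedModType R[i]) (T : V -> W) : Prop :=
  exists M : R[i], forall x, `|T x| <= M * `|x|.

Definition rank_one (V W : normedModType R[i]) (T : {linear V -> W}) : Prop :=
  exists2 w : W, w != 0 & range T = range (fun c : R[i] => c *: w).

Definition Daugavet (W : completeNormedModType R[i]) : Prop :=
  forall T : {linear W -> W}, bounded_op T -> rank_one T ->
    opnorm (fun x => x + T x) = 1 + opnorm T.

(* The property Vector.axiom of the library, as a Prop. *)
Definition has_dim (n : nat) (E : lmodType R[i]) : Prop :=
  exists2 f : E -> 'rV[R[i]]_n, linear f & bijective f.

End daugavet.

(* Main.v *)
Require Import Defs.
From mathcomp Require Import all_boot all_order all_algebra complex.
From mathcomp Require Import all_classical all_reals all_analysis.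
From HB Require Import structures.
From mathcomp Require Import ring lra.
Set Implicit Arguments.
Unset Strict Implicit.
Unset Printing Implicit Defensive.
Import Order.TTheory GRing.Theory Num.Theory.
Import numFieldNormedType.Exports measurable_realfun.
Local Open Scope classical_set_scope.
Local Open Scope ring_scope.
Local Open Scope complex_scope.

(* Take E = C^2 with norm |b| + max(|a|, |b|), and let u = x (x) e1 + y (x) e2
   have norm at most 1. For every fourth root of unity w the functional
   (a, b) |-> a + w b has norm at most 1 on E, so ||x + w y||_1 <= 1. On the other
   hand the average of |a + w b| over the four w exceeds |a| by about
   |b|^2 / (4 |a|), so if ||x||_1 is close to 1 then y must be small. For the
   operator T u = (F (x) e1')(u) . (1 (x) e2 / 2), where F is a norm-one functional
   that norms the constant 1, ||u + T u|| close to 2 would force ||x||_1 close to 1,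
   hence y small; but the functionals of the dual ball of E take values alpha, beta
   at e1, e2 with |alpha| <= 1 and |alpha| + |beta| <= 2, which keeps
   |alpha| ||x||_1 + |beta| (||y||_1 + 1/2) away from 2. *)

(** * Complex estimates, and functionals recovered from their real part *)

Section complex_numbers.
Variable R : realType.
Implicit Types (a b c z : R[i]) (V : normedModType R[i]).

Lemma rnormN V (x : V) : rnorm (- x) = rnorm x.
Proof. by rewrite /rnorm normrN. Qed.

Lemma rnorm0 V : rnorm (0 : V) = 0.
Proof. by rewrite /rnorm normr0. Qed.

Lemma rnormM a b : rnorm (a * b) = rnorm a * rnorm b.
Proof. exact: (rnormcZ a (b : R[i])). Qed.

Lemma rnorm_conj z : rnorm z^*%C = rnorm z.
Proof. by rewrite !rnormc_sqrt; case: z => x y /=; rewrite sqrrN. Qed.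

Lemma rnorm_real (x : R) : rnorm x%:C = `|x|.
Proof. by rewrite rnormc_sqrt /= expr0n addr0 sqrtr_sqr. Qed.

Lemma rnorm1 : rnorm (1 : R[i]) = 1.
Proof. by rewrite /rnorm normr1. Qed.

Lemma rnormi : rnorm ('i%C : R[i]) = 1.
Proof. by rewrite rnormc_sqrt /= expr0n expr1n add0r sqrtr1. Qed.

Lemma rnorm_gt0 z : z != 0 -> 0 < rnorm z.
Proof. by move=> z0; rewrite -ltcR rnormE normr_gt0. Qed.

Lemma rnorm_le1 V (x : V) : (`|x| <= 1) = (rnorm x <= 1).
Proof. by rewrite -rnormE -(lecR (rnorm x) 1). Qed.

Lemma dual_ball_rnorm V (f : dual_ball V) (x : V) : rnorm (f x) <= rnorm x.
Proof. by rewrite -lecR !rnormE dual_ballP. Qed.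

(* A supporting line of the unit circle at (24/25, 7/25). *)
Lemma rnorm_ge_ReIm z :
  24%:R / 25%:R * `|complex.Re z| + 7%:R / 25%:R * `|complex.Im z| <= rnorm z.
Proof.
rewrite rnormc_sqrt; case: z => x y /=.
rewrite -(real_normK (num_real x)) -(real_normK (num_real y)).
move: (normr_ge0 x) (normr_ge0 y); set X := `|x|; set Y := `|y| => X0 Y0.
set t := (X in X <= _).
have t0 : 0 <= t by rewrite /t; lra.
rewrite -(ger0_norm t0) -sqrtr_sqr ler_sqrt ?addr_ge0 ?sqr_ge0// /t.
rewrite -subr_ge0.
(* Lagrange's identity for the unit vector (24/25, 7/25). *)
have -> : X ^+ 2 + Y ^+ 2 - (24%:R / 25%:R * X + 7%:R / 25%:R * Y) ^+ 2 =
  (7%:R / 25%:R * X - 24%:R / 25%:R * Y) ^+ 2 by field.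
exact: sqr_ge0.
Qed.

Lemma rnorm_four_points1 z :
  4%:R * (24%:R / 25%:R + 7%:R / 50%:R * rnorm z) <=
  rnorm (1 + z) + rnorm (1 - z) + rnorm (1 + 'i%C * z) + rnorm (1 - 'i%C * z).
Proof.
have := rnorm_ge_ReIm (1 + z); have := rnorm_ge_ReIm (1 - z).
have := rnorm_ge_ReIm (1 + 'i%C * z); have := rnorm_ge_ReIm (1 - 'i%C * z).
have := rnorm_le_ReIm z.
case: z => x y /=; set n1 := rnorm _; set n2 := rnorm _; set n3 := rnorm _.
set n4 := rnorm _; set n5 := rnorm _.
rewrite !(mul0r, mul1r) !sub0r !add0r opprK !normrN.
have := ler_norm (1 - x); have := ler_norm (1 + x).
have := ler_norm (1 - y); have := ler_norm (1 + y).
by lra.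
Qed.

(* The fourth roots of unity see both the real and the imaginary part of b / a;
   the real roots alone do not, whence the need of complex scalars. *)
Lemma rnorm_four_points a b :
  4%:R * (24%:R / 25%:R * rnorm a + 7%:R / 50%:R * rnorm b) <=
  rnorm (a + b) + rnorm (a - b) + rnorm (a + 'i%C * b) + rnorm (a - 'i%C * b).
Proof.
have [->|a0] := eqVneq a 0.
  rewrite !add0r !rnormN !rnormM rnorm0 rnormi.
  have := rnorm_ge0 b; lra.
(* Homogeneity: factoring out a reduces the claim to [rnorm_four_points1]. *)
have -> : b = a * (b / a) by rewrite mulrC divfK.
move: (b / a) => z; rewrite [in _ * (a * z)]mulrCA.
have -> : a + a * z = a * (1 + z) by rewrite mulrDr mulr1.
have -> : a - a * z = a * (1 - z) by rewrite mulrBr mulr1.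
have -> : a + a * ('i%C * z) = a * (1 + 'i%C * z) by rewrite mulrDr mulr1.
have -> : a - a * ('i%C * z) = a * (1 - 'i%C * z) by rewrite mulrBr mulr1.
rewrite !rnormM.
have := ler_wpM2l (rnorm_ge0 a) (rnorm_four_points1 z).
by rewrite !mulrDr; lra.
Qed.

(* The conjugate of the sign of z (0 at z = 0). *)
Definition csgn z : R[i] := z^*%C / (rnorm z)%:C.

Lemma mul_csgn z : z * csgn z = (rnorm z)%:C.
Proof.
rewrite /csgn; have [->|/rnorm_gt0 z0] := eqVneq z 0.
  by rewrite mul0r rnorm0.
have zC0 : (rnorm z)%:C != 0 by rewrite (inj_eq (@complexI R)) gt_eqF.
rewrite mulrA; apply: (canLR (mulfK zC0)).
rewrite -rmorphM -expr2 rnormc_sqrt sqr_sqrtr ?addr_ge0 ?sqr_ge0//.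
by case: z {z0 zC0} => x y; simpc => /=; congr (_ +i* _); ring.
Qed.

Lemma rnorm_csgn z : rnorm (csgn z) <= 1.
Proof.
rewrite /csgn rnormM rnorm_conj -fmorphV rnorm_real.
rewrite ger0_norm ?invr_ge0 ?rnorm_ge0//.
have [->|n0] := eqVneq (rnorm z) 0; first by rewrite mul0r.
by rewrite mulfV.
Qed.

Lemma Re_mul_csgn a z : complex.Re (a * csgn z) =
  (complex.Re a * complex.Re z + complex.Im a * complex.Im z) * (rnorm z)^-1.
Proof.
rewrite /csgn -fmorphV; move: (rnorm z)^-1 => t.
by case: a z => [a1 a2] [z1 z2] /=; ring.
Qed.

Lemma Re_mul_csgn_le a z : `|complex.Re (a * csgn z)| <= rnorm a.
Proof.
apply: le_trans (ler_Re_rnorm _) _; rewrite rnormM.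
by rewrite ler_piMr ?rnorm_ge0 ?rnorm_csgn.
Qed.

(* A complex-linear functional is determined by its real part r, as
   x |-> r x - i r (i x). *)
Lemma dual_ball_of_Re V (r : V -> R) :
    {morph r : x y / x + y} ->
    (forall (t : R) x, r (t%:C *: x) = t * r x) ->
    (forall x, r x <= rnorm x) ->
  exists f : dual_ball V, forall x, complex.Re (f x) = r x.
Proof.
move=> rD rZ rle.
pose f x : R[i] := r x +i* - r ('i%C *: x).
have fl : linear f.
  case=> s t x y; rewrite /f.
  have e1 : (s +i* t) = s%:C + t%:C * 'i%C :> R[i] by simpc.
  have e2 : 'i%C *: ((s +i* t) *: x) = s%:C *: ('i%C *: x) + (- t)%:C *: x.
    rewrite !scalerA -scalerDl; congr (_ *: x); simpc.
    by apply/eqP; rewrite eq_complex /=; apply/andP; split; apply/eqP; ring.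
  rewrite scalerDr !rD e2 rD !rZ e1 scalerDl -scalerA rD !rZ.
  apply/eqP; rewrite eq_complex /=; apply/andP; split; apply/eqP; ring.
pose fL : {linear V -> R[i]} := HB.pack f (GRing.isLinear.Build _ _ _ _ f fl).
have fle x : `|fL x| <= `|x|.
  rewrite -!rnormE lecR.
  (* Rotating x by [csgn (fL x)] makes the value of the functional real, hence equal to that of
     r. *)
  have -> : rnorm (fL x) = r (csgn (fL x) *: x).
    rewrite -[RHS]/(complex.Re (fL _)).
    have -> : fL (csgn (fL x) *: x) = csgn (fL x) * fL x by rewrite linearZ.
    by rewrite mulrC mul_csgn.
  apply: le_trans (rle _) _; rewrite rnormcZ.
  by rewrite ler_piMl ?rnorm_ge0 ?rnorm_csgn.
by exists (DualBall fle).
Qed.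
End complex_numbers.

(** * Norming functionals on L1 and the integrated four-point inequality *)

Section L1_duality.
Variable R : realType.
Local Notation I01 := (`[0%R, 1%R]%classic : set (measurableTypeR R)).
Local Notation mu := (@lebesgue_measure R).
Implicit Types f g h : L1fun R.

Let mI : measurable I01. Proof. exact: measurable_itv. Qed.

Lemma rnorm_L1class f : rnorm (L1class f) = \int[mu]_(t in I01) rnorm (f t).
Proof. by rewrite -L1normE /rnorm L1_normE. Qed.

Lemma integrable_Re_mul_csgn f h :
  mu.-integrable I01 (EFin \o (fun t => complex.Re (f t * csgn (h t)))).
Proof.
apply: (le_integrable mI _ _ (integrable_rnorm_L1 f)); last first.
  move=> t _ /=; rewrite lee_fin [leRHS]ger0_norm ?rnorm_ge0//.
  exact: Re_mul_csgn_le.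
apply/measurable_EFinP.
have [/measurable_int/measurable_EFinP f1 /measurable_int/measurable_EFinP f2] := L1funP f.
have [/measurable_int/measurable_EFinP h1 /measurable_int/measurable_EFinP h2] := L1funP h.
(* The reciprocal becomes a power of exponent -1 so that [measurable_powR] applies; at 0 both are
   0. *)
rewrite (_ : (fun _ => _) = fun t => (complex.Re (f t) * complex.Re (h t) +
   complex.Im (f t) * complex.Im (h t)) * (rnorm (h t) `^ (-1))); last first.
  by apply/funext => t; rewrite powR_inv1 ?rnorm_ge0// Re_mul_csgn.
apply: measurable_funM.
  by apply: measurable_realfun.measurable_funD; exact: measurable_funM.
exact: (measurableT_comp (measurable_powR (-1)) (measurable_rnorm_L1 h)).
Qed.

(** The real part of integration against the bounded function [csgn h], the functional that norms
    the class of h. *)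
Definition sign_pairing h (x : L1 R) : R :=
  \int[mu]_(t in I01) complex.Re (L1repr x t * csgn (h t)).

Lemma sign_pairingE h f :
  sign_pairing h (L1class f) = \int[mu]_(t in I01) complex.Re (f t * csgn (h t)).
Proof.
rewrite /sign_pairing /Rintegral; congr fine; apply: ae_eq_integral => //.
- exact: measurable_int (integrable_Re_mul_csgn _ _).
- exact: measurable_int (integrable_Re_mul_csgn _ _).
have /L1classP := L1reprK (L1class f).
by apply: filterS => t ft It; rewrite ft.
Qed.

(** Integration against the conjugate sign of x norms x; [dual_ball_of_Re] builds this functional
    from its real part [sign_pairing]. *)
Lemma L1_norming (x : L1 R) : exists f : dual_ball (L1 R), rnorm x <= rnorm (f x).
Proof.
elim/L1ind: x => h.
have rD : {morph sign_pairing h : x y / x + y}.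
  elim/L1ind => f; elim/L1ind => g; rewrite -raddfD !sign_pairingE.
  rewrite -RintegralD//; try exact: integrable_Re_mul_csgn.
  by apply: eq_Rintegral => t _; rewrite -raddfD -mulrDl.
have rZ (c : R) x : sign_pairing h (c%:C *: x) = c * sign_pairing h x.
  elim/L1ind: x => f; rewrite -[_ *: _]/(L1scale _ _) L1scaleE !sign_pairingE.
  rewrite -RintegralZl//; last exact: integrable_Re_mul_csgn.
  apply: eq_Rintegral => t _; rewrite -[(c%:C *: f) t]/(c%:C * f t) -mulrA.
  by case: (_ * csgn _) => u v /=; rewrite mul0r subr0.
have rle x : sign_pairing h x <= rnorm x.
  elim/L1ind: x => f; rewrite sign_pairingE rnorm_L1class.
  apply: le_Rintegral => //.
  - exact: integrable_Re_mul_csgn.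
  - exact: integrable_rnorm_L1.
  - by move=> t _; exact: le_trans (ler_norm _) (Re_mul_csgn_le _ _).
have [f fE] := dual_ball_of_Re rD rZ rle.
exists f; apply: le_trans (ler_Re_rnorm _); apply: le_trans (ler_norm _).
rewrite fE sign_pairingE rnorm_L1class.
by under [leRHS]eq_Rintegral do rewrite mul_csgn.
Qed.

Let muI : mu I01 = 1%E.
Proof. by rewrite lebesgue_measure_itv /= lte_fin ltr01 -EFinB subr0. Qed.

Let integrable_cst01 (k : R) : mu.-integrable I01 (EFin \o (fun=> k)).
Proof.
apply/integrableP; split; first exact/measurable_EFinP.
have -> : (\int[mu]_(t in I01) `|(EFin \o (fun=> k)) t| = `|k|%:E * mu I01)%E.
  exact: integral_cst.
by rewrite muI mule1 ltry.
Qed.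

Lemma integrableC_one : (fun=> 1 : R[i]) \in @L1_pred R.
Proof. by apply/asboolP; split; exact: integrable_cst01. Qed.

Lemma L1_unit : exists x : L1 R, rnorm x = 1.
Proof.
exists (L1class (L1Fun integrableC_one)); rewrite rnorm_L1class /= rnorm1.
have -> : \int[mu]_(t in I01) (1 : R) = 1 * fine (mu I01) by exact: Rintegral_cst.
by rewrite muI mulr1.
Qed.

(** The pointwise bound [rnorm_four_points], integrated over [0, 1]. *)
Lemma L1_four_points (x y : L1 R) :
  4%:R * (24%:R / 25%:R * rnorm x + 7%:R / 50%:R * rnorm y) <=
  rnorm (x + y) + rnorm (x - y) + rnorm (x + 'i%C *: y) + rnorm (x - 'i%C *: y).
Proof.
elim/L1ind: x => f; elim/L1ind: y => g.
have -> : L1class f + L1class g = L1class (f + g) by rewrite raddfD.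
have -> : L1class f - L1class g = L1class (f - g) by rewrite raddfB.
have -> : L1class f + 'i%C *: L1class g = L1class (f + 'i%C *: g).
  by rewrite -[_ *: _]/(L1scale _ _) L1scaleE raddfD.
have -> : L1class f - 'i%C *: L1class g = L1class (f - 'i%C *: g).
  by rewrite -[_ *: _]/(L1scale _ _) L1scaleE raddfB.
rewrite !rnorm_L1class.
have If h := integrable_rnorm_L1 h.
have IZ (c : R) (u : R -> R) : mu.-integrable I01 (EFin \o u) ->
    mu.-integrable I01 (EFin \o (fun t => c * u t)).
  by move=> iu; exact: (integrableZl mI c iu).
have ID (u v : R -> R) : mu.-integrable I01 (EFin \o u) ->
    mu.-integrable I01 (EFin \o v) ->
    mu.-integrable I01 (EFin \o (fun t => u t + v t)).
  by move=> iu iv; exact: (integrableD mI iu iv).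
rewrite -!RintegralZl// -!RintegralD//; try by do ?[apply: (ID)|apply: (IZ)].
rewrite -RintegralZl//; last by apply: (ID); exact: (IZ).
apply: le_Rintegral => //; last by move=> t _;
  exact: (rnorm_four_points (f t) (g t)).
  by apply: (IZ); apply: (ID); exact: (IZ).
all: by do ?apply: (ID).
Qed.

End L1_duality.

(** * The two-dimensional space E and its dual ball *)

Section plane.
Variable R : realType.

Definition plane : Type := (R[i] * R[i])%type.
HB.instance Definition _ := GRing.Lmodule.copy plane (R[i] * R[i])%type.

Implicit Types x y : plane.

(** At (a, b) this is max(|a| + |b|, 2 |b|). The dual ball is |alpha| <= 1, |alpha| + |beta| <= 2,
    by [plane_dual_ball] and [plane_dual_ball_le]. *)
Definition plane_norm x : R := rnorm x.2 + Num.max (rnorm x.1) (rnorm x.2).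

Let plane_normD x y : (plane_norm (x + y))%:C <= (plane_norm x)%:C + (plane_norm y)%:C.
Proof.
rewrite -rmorphD lecR /plane_norm /=.
have := rnormD x.1 y.1; have := rnormD x.2 y.2.
have := le_max (rnorm x.1) (rnorm x.1) (rnorm x.2); rewrite lexx /= => h1.
have := le_max (rnorm x.2) (rnorm x.1) (rnorm x.2); rewrite lexx orbT => h2.
have := le_max (rnorm y.1) (rnorm y.1) (rnorm y.2); rewrite lexx /= => h3.
have := le_max (rnorm y.2) (rnorm y.1) (rnorm y.2); rewrite lexx orbT => h4.
move=> k2 k1; rewrite addrACA lerD// ge_max; apply/andP; split; lra.
Qed.

Let plane_normZ (c : R[i]) x : (plane_norm (c *: x))%:C = `|c| * (plane_norm x)%:C.
Proof.
rewrite -(rnormE (c : R[i])) -rmorphM /plane_norm; congr _%:C.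
have -> : (c *: x).1 = c * x.1 by [].
have -> : (c *: x).2 = c * x.2 by [].
by rewrite !rnormM mulrDr maxr_pMr ?rnorm_ge0.
Qed.

Let plane_norm0 x : (plane_norm x)%:C = 0 -> x = 0.
Proof.
move=> /complexI; rewrite /plane_norm => x0.
have h1 : rnorm x.1 <= Num.max (rnorm x.1) (rnorm x.2) by rewrite le_max lexx.
have h2 := rnorm_ge0 x.1; have h3 := rnorm_ge0 x.2.
case: x x0 h1 h2 h3 => a b /= x0 h1 h2 h3.
have /rnorm0_eq0 -> : rnorm a = 0 by lra.
by have /rnorm0_eq0 -> : rnorm b = 0 by lra.
Qed.

HB.instance Definition _ :=
  Lmodule_isNormed.Build R[i] plane plane_normD plane_normZ plane_norm0.

Lemma plane_normE x : rnorm x = rnorm x.2 + Num.max (rnorm x.1) (rnorm x.2).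
Proof. by []. Qed.

(** The coordinates are nonexpansive, hence converge; the norm is a sum of two terms, each below e /
    2 once both coordinates are. *)
Lemma plane_complete (F : set_system plane) : ProperFilter F -> cauchy F -> cvg F.
Proof.
move=> FF /rnorm_cauchyP Fc.
have cC (g : plane -> R[i]) :
    (forall x y, rnorm (g x - g y) <= rnorm (x - y)) -> cvg (g @ F).
  move=> gl; apply: cauchy_cvg; apply/rnorm_cauchyP => e /Fc[u Fu].
  exists (g u).
  suff : F (g @^-1` [set v | rnorm (g u - v) < e]) by [].
  by apply: filterS Fu => v /= uv; exact: le_lt_trans (gl u v) uv.
have c1 : cvg ((fun x : plane => x.1 : R[i]) @ F).
  apply: cC => x y; rewrite plane_normE.
  have := rnorm_ge0 (x - y).2.
  have := le_max (rnorm (x - y).1) (rnorm (x - y).1) (rnorm (x - y).2).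
  by rewrite lexx /= => h1 h2; rewrite -[x.1 - y.1]/(x - y).1; lra.
have c2 : cvg ((fun x : plane => x.2 : R[i]) @ F).
  apply: cC => x y; rewrite plane_normE.
  have := rnorm_ge0 (x - y).1.
  have := le_max (rnorm (x - y).1) (rnorm (x - y).1) (rnorm (x - y).2).
  by rewrite lexx /= => h1 h2; rewrite -[x.2 - y.2]/(x - y).2; lra.
apply/cvg_ex; exists ((lim ((fun x : plane => x.1 : R[i]) @ F),
  lim ((fun x : plane => x.2 : R[i]) @ F)) : plane).
apply/rnorm_cvgP => e e0.
have e20 : 0 < e / 2 by rewrite divr_gt0.
have /rnorm_cvgP/(_ _ e20) F1 : (fun x : plane => x.1 : R[i]) @ F -->
  lim ((fun x : plane => x.1 : R[i]) @ F) by exact: c1.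
have /rnorm_cvgP/(_ _ e20) F2 : (fun x : plane => x.2 : R[i]) @ F -->
  lim ((fun x : plane => x.2 : R[i]) @ F) by exact: c2.
have {}F1 : F [set x : plane |
    rnorm (lim ((fun x : plane => x.1 : R[i]) @ F) - x.1) < e / 2].
  exact: F1.
have {}F2 : F [set x : plane |
    rnorm (lim ((fun x : plane => x.2 : R[i]) @ F) - x.2) < e / 2].
  exact: F2.
apply: filterS2 F1 F2 => -[a b] /= ha hb; rewrite plane_normE.
by rewrite [ltRHS](splitr e) ltrD// gt_max ha hb.
Qed.

HB.instance Definition _ := Uniform_isComplete.Build plane plane_complete.

Lemma plane_dim : has_dim 2 plane.
Proof.
exists (fun x => \row_j (if j == 0 then x.1 else x.2)).
  by move=> c x y; apply/rowP => j; rewrite !mxE; case: ifP.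
exists (fun v : 'rV[R[i]]_2 => (v 0 0, v 0 1) : plane).
  by case=> a b; rewrite !mxE.
move=> v; apply/rowP => j; rewrite !mxE /=.
by case: (unliftP 0 j) => [k ->|-> //]; rewrite (ord1 k) /=; congr (v 0 _); apply: val_inj.
Qed.

Definition e1 : plane := (1, 0).
Definition e2 : plane := (0, 1).

Lemma plane_basis x : x = x.1 *: e1 + x.2 *: e2.
Proof.
case: x => a b; apply/pair_equal_spec; split => /=.
  by rewrite -[_ *: _]/(a * 1) -[_ *: _]/(b * 0) mulr1 mulr0 addr0.
by rewrite -[_ *: _]/(a * 0) -[_ *: _]/(b * 1) mulr1 mulr0 add0r.
Qed.

Lemma plane_dual_ball (a b : R[i]) : rnorm a <= 1 -> rnorm a + rnorm b <= 2 ->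
  exists f : dual_ball plane, f e1 = a /\ f e2 = b.
Proof.
move=> a1 ab.
pose f x : R[i] := x.1 * a + x.2 * b.
have fl : linear f.
  move=> c x y; rewrite /f.
  have -> : (c *: x + y).1 = c * x.1 + y.1 by [].
  have -> : (c *: x + y).2 = c * x.2 + y.2 by [].
  by rewrite -[c *: _]/(c * _); ring.
pose fL : {linear plane -> R[i]} := HB.pack f (GRing.isLinear.Build _ _ _ _ f fl).
have fle x : `|fL x| <= `|x|.
  rewrite -!rnormE lecR plane_normE.
  apply: le_trans (rnormD _ _) _; rewrite !rnormM.
  have h1 : rnorm x.1 <= Num.max (rnorm x.1) (rnorm x.2) by rewrite le_max lexx.
  have h2 : rnorm x.2 <= Num.max (rnorm x.1) (rnorm x.2) by rewrite le_max lexx orbT.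
  have := rnorm_ge0 a; have := rnorm_ge0 b; have := rnorm_ge0 x.1; have := rnorm_ge0 x.2.
  (* With A = |a| and B = |b|, B <= 2 - A gives the bound |x.2| + (A |x.1| + (1 - A) |x.2|), whose
     bracket is a convex combination of |x.1| and |x.2|. *)
  by nra.
exists (DualBall fle); rewrite /= /f /=; split; ring.
Qed.

Lemma plane_dual_ballE (f : dual_ball plane) x : f x = x.1 * f e1 + x.2 * f e2.
Proof. by rewrite {1}(plane_basis x) linearD !linearZ. Qed.

Lemma plane_dual_ball_le (f : dual_ball plane) :
  rnorm (f e1) <= 1 /\ rnorm (f e1) + rnorm (f e2) <= 2.
Proof.
have n0 : rnorm (0 : R[i]) = 0 by rewrite rnorm0.
have n1 := rnorm1 R.
split.
  apply: le_trans (dual_ball_rnorm _ _) _; rewrite plane_normE /= n0 n1.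
  by rewrite add0r ge_max lexx ler01.
(* The phases turn both terms of f x into nonnegative reals, and this vector has norm at most 2. *)
pose x : plane := (csgn (f e1), csgn (f e2)).
have -> : rnorm (f e1) + rnorm (f e2) = rnorm (f x).
  rewrite (plane_dual_ballE f x) /x /= !(mulrC (csgn _)) !mul_csgn.
  by rewrite -rmorphD rnorm_real ger0_norm ?addr_ge0 ?rnorm_ge0.
apply: le_trans (dual_ball_rnorm _ _) _; rewrite plane_normE /=.
have c1 := rnorm_csgn (f e1); have c2 := rnorm_csgn (f e2).
have : Num.max (rnorm (csgn (f e1))) (rnorm (csgn (f e2))) <= 1 by rewrite ge_max c1.
lra.
Qed.

End plane.

(** * Near-extremal vectors for rank-one operators *)

Section rank_one_operators.
Variable R : realType.

(** The operator u |-> phi(u) y has norm at least 1, as w shows, so the Daugavet equation makes the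
    supremum of ||u + phi(u) y|| over the unit ball at least 2. *)
Lemma Daugavet_rank_one (W : completeNormedModType R[i]) (phi : dual_ball W)
    (w y : W) : Daugavet W ->
    rnorm w <= 1 -> rnorm (phi w) = 1 -> rnorm y = 1 ->
  forall d : R, 0 < d ->
    exists u : W, rnorm u <= 1 /\ 2%:R - d < rnorm (u + phi u *: y).
Proof.
move=> DW w1 phiw y1 d d0.
pose T (u : W) := phi u *: y.
have Tl : linear T by move=> c u v; rewrite /T linearP scalerDl scalerA.
pose TL : {linear W -> W} := HB.pack T (GRing.isLinear.Build _ _ _ _ T Tl).
have Tle u : rnorm (T u) <= rnorm u.
  by rewrite rnormcZ y1 mulr1 dual_ball_rnorm.
have Tb : bounded_op TL.
  by exists 1 => u; rewrite mul1r -!rnormE lecR; exact: Tle.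
have T1 : rank_one TL.
  exists y.
    by apply/eqP => y0; move: y1; rewrite y0 rnorm0 => /esym/eqP; rewrite oner_eq0.
  apply/seteqP; split=> [_ [u _ <-]|_ [c _ <-]]; first by exists (phi u).
  have phi0 : phi w != 0.
    by apply/eqP => e; move: phiw; rewrite e rnorm0 => /esym/eqP; rewrite oner_eq0.
  exists ((c / phi w) *: w) => //.
  rewrite -[TL _]/(phi _ *: y).
  have -> : phi ((c / phi w) *: w) = c / phi w * phi w by rewrite linearZ.
  by rewrite divfK.
have opT : 1 <= opnorm TL.
  apply: sup_upper_bound.
    split; first by exists (rnorm (TL w)), w => //=; rewrite rnorm_le1.
    by exists 1 => _ [u /= u1 <-]; rewrite (le_trans (Tle u))// -rnorm_le1.
  exists w; first by rewrite /= rnorm_le1.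
  by rewrite -[TL w]/(phi w *: y) rnormcZ phiw y1 mulr1.
have := DW TL Tb T1; rewrite /opnorm; set S := [set _ | _ in _] => DT.
have hS : has_sup S.
  split; first by exists (rnorm (w + TL w)), w => //=; rewrite rnorm_le1.
  exists 2 => _ [u /= u1 <-]; apply: le_trans (rnormD _ _) _.
  have : rnorm (TL u) <= rnorm u by exact: Tle.
  by move: u1; rewrite rnorm_le1; lra.
have [_ [u /= u1 <-] ud] := sup_adherent d0 hS.
exists u; rewrite -rnorm_le1; split => //.
apply: le_lt_trans ud; rewrite DT lerD2r.
by move: opT; rewrite /opnorm; lra.
Qed.

End rank_one_operators.

(** * Approximation by two elementary tensors *)

Section injective_tensor_plane.
Variables (R : realType) (X : normedModType R[i]).
Local Notation E := (plane R).
Implicit Types (u : inj_tensor X E) (p : dual_ball X * dual_ball E).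

(** Expanding the second factors in the basis [e1], [e2] collects a finite sum of tensors into two;
    the error e is that of approximating u by a finite sum. *)
Lemma inj_tensor_plane_approx u (e : R) : 0 < e -> exists x y : X, forall p,
  rnorm (u p - (p.1 x * p.2 (e1 R) + p.1 y * p.2 (e2 R))) <= e.
Proof.
move=> e0; have /asboolP/(_ e e0)[s us] := valP u.
exists (\sum_(xy <- s) xy.2.1 *: xy.1), (\sum_(xy <- s) xy.2.2 *: xy.1) => p.
suff <- : elem_tensors s p = p.1 (\sum_(xy <- s) xy.2.1 *: xy.1) * p.2 (e1 R) +
  p.1 (\sum_(xy <- s) xy.2.2 *: xy.1) * p.2 (e2 R) by exact: us.
rewrite /elem_tensors !linear_sum !mulr_suml -big_split; apply: eq_bigr => xy _ /=.
have pZ c : p.1 (c *: xy.1) = c * p.1 xy.1 by rewrite linearZ.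
by rewrite (plane_dual_ballE p.2 xy.2) !pZ; ring.
Qed.

End injective_tensor_plane.

(** * Failure of the Daugavet property for the tensor product *)

Section counterexample.
Variable R : realType.
Local Notation K := (dual_ball (L1 R) * dual_ball (plane R))%type.
Local Notation W := (inj_tensor (L1 R) (plane R)).
Local Notation e1 := (e1 R).
Local Notation e2 := (e2 R).

(** For |w| = 1 the pair (1, w) lies in the dual ball of E, so ||x + w y|| <= 1 + e. Summing over
    the fourth roots of unity and using [L1_four_points] shows that y is small when ||x|| is near
    1. *)
Lemma plane_tensor_pert (x y : L1 R) (e : R) :
    (forall p : K,
      rnorm (p.1 x * p.2 e1 + p.1 y * p.2 e2) <= 1 + e) ->
    7%:R / 50%:R * rnorm y <= 1 + e - 24%:R / 25%:R * rnorm x.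
Proof.
move=> xy.
have r1 := rnorm1 R.
have ri := rnormi R.
have le1 (w : R[i]) : rnorm w = 1 -> rnorm (x + w *: y) <= 1 + e.
  move=> w1; have [f fxy] := L1_norming (x + w *: y).
  have [||a [a1 a2]] := @plane_dual_ball R 1 w; rewrite ?r1 ?w1//.
  have := xy (f, a); rewrite /= a1 a2 mulr1.
  have <- : f (x + w *: y) = f x + f y * w by rewrite linearD linearZ mulrC.
  exact: le_trans fxy.
have := L1_four_points x y.
have := le1 1 r1; have := le1 (-1); rewrite rnormN r1 => /(_ erefl).
have := le1 'i%C ri; have := le1 (- 'i%C); rewrite rnormN ri => /(_ erefl).
by rewrite !scaleNr !scale1r; lra.
Qed.

Lemma tensor_plane_not_Daugavet : ~ Daugavet W.
Proof.
move=> DW.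
have r1 := rnorm1 R.
have r2 : rnorm (2%:R : R[i]) = 2%:R by rewrite /rnorm normr_nat.
have r0 : rnorm (0 : R[i]) = 0 by rewrite rnorm0.
have [one one1] := L1_unit R; have [f0 f01] := L1_norming one.
have f0one : rnorm (f0 one) = 1.
  by have := dual_ball_rnorm f0 one; lra.
have [||a0 [a01 a02]] := @plane_dual_ball R 1 0; rewrite ?r1 ?r0 ?addr0 ?ler1n//.
have [||b0 [_ b02]] := @plane_dual_ball R 0 2%:R.
- by rewrite r0.
- by rewrite r0 r2 add0r.
(* [e2] has norm 2, as [b0] witnesses, so this factor makes y below a unit vector. *)
pose h : R[i] := 2^-1.
have h2 : rnorm h = 2^-1.
  have : rnorm h * rnorm (2%:R : R[i]) = 1 by rewrite -rnormM mulVf ?r1 ?pnatr_eq0.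
  by rewrite r2; lra.
pose p0 : K := (f0, a0).
pose phi (u : W) : R[i] := u p0.
have phil : linear phi by [].
pose phiL : {linear W -> R[i]} := HB.pack phi (GRing.isLinear.Build _ _ _ _ phi phil).
have phile u : `|phiL u| <= `|u| by rewrite -!rnormE lecR; exact: le_inj_norm.
pose y : W := tensor one (h *: e2).
have yE p : y p = p.1 one * (h * p.2 e2).
  by rewrite -[LHS]/(tensor _ _ p) tensorE linearZ.
have nb (b : dual_ball (plane R)) := plane_dual_ball_le b.
have y1 : rnorm y = 1.
  apply/eqP; rewrite eq_le; apply/andP; split.
    apply: inj_norm_le => p; rewrite yE !rnormM h2.
    have := dual_ball_rnorm p.1 one; rewrite one1.
    have [] := nb p.2; have := rnorm_ge0 (p.2 e1); have := rnorm_ge0 (p.2 e2).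
    have := rnorm_ge0 (p.1 one); by nra.
  have := le_inj_norm y (f0, b0); rewrite yE !rnormM h2 f0one b02.
  by rewrite r2 mul1r mulVf ?pnatr_eq0.
(* The tolerance serves twice: for the defect from 2 and for the two-tensor approximation of u. *)
have d0 : 0 < 200%:R^-1 :> R by rewrite invr_gt0.
have [||u [u1 ud]] :=
  @Daugavet_rank_one R W (DualBall phile) (tensor one e1) y DW _ _ y1 _ d0.
- apply: inj_norm_le => p; rewrite tensorE rnormM.
  have := dual_ball_rnorm p.1 one; rewrite one1.
  have [] := nb p.2; have := rnorm_ge0 (p.2 e1); have := rnorm_ge0 (p.2 e2).
  have := rnorm_ge0 (p.1 one); by nra.
- by rewrite -[DualBall phile _]/(tensor one e1 p0) tensorE rnormM /= a01 r1 mulr1.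
have up p : rnorm (u p) <= 1 by exact: le_trans (le_inj_norm u p) u1.
have [x [z uxz]] := inj_tensor_plane_approx u d0.
have xzle (p : K) : rnorm (p.1 x * p.2 e1 + p.1 z * p.2 e2) <= 1 + 200%:R^-1.
  set v := _ + _; have -> : v = u p - (u p - v) by rewrite subKr.
  apply: le_trans (rnormD _ _) _; rewrite rnormN lerD//; exact: uxz.
have zle := plane_tensor_pert xzle.
have c1 : 1 - 200%:R^-1 < rnorm (u p0).
  have := rnormD u (u p0 *: y); rewrite rnormcZ y1 mulr1.
  by move: ud u1; rewrite -[DualBall phile u]/(u p0); lra.
(* Since [a0] kills [e2], evaluation at [p0] sees only [f0 x]. *)
have xge : rnorm (u p0) - 200%:R^-1 <= rnorm x.
  have := uxz p0; rewrite /= a01 a02 mulr1 mulr0 addr0 => k.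
  have := dual_ball_rnorm f0 x.
  have := rnormD (u p0 - f0 x) (f0 x); rewrite subrK; lra.
have xle : rnorm x <= 1 + 200%:R^-1.
  have [f fx] := L1_norming x.
  by have := xzle (f, a0); rewrite /= a01 a02 mulr1 mulr0 addr0; exact: le_trans.
suff : rnorm (u + u p0 *: y) <= 2%:R - 200%:R^-1.
  by move: ud; rewrite -[DualBall phile u]/(u p0); lra.
apply: inj_norm_le => p.
rewrite -[(u + _) p]/(u p + u p0 * y p).
set v := p.1 x * p.2 e1 + p.1 z * p.2 e2.
have -> : u p + u p0 * y p = (u p - v) + (v + u p0 * y p) by rewrite addrA subrK.
apply: le_trans (rnormD _ _) _.
have := uxz p; rewrite -/v => k1.
have k2 := rnormD v (u p0 * y p).
have k3 := rnormD (p.1 x * p.2 e1) (p.1 z * p.2 e2).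
move: k2 k3; rewrite -/v !rnormM yE !rnormM h2.
have := dual_ball_rnorm p.1 one; rewrite one1 => k4.
have k5 := dual_ball_rnorm p.1 x; have k6 := dual_ball_rnorm p.1 z.
have [n1 n2] := nb p.2; have k7 := up p0.
move: (rnorm_ge0 (p.1 one)) (rnorm_ge0 (p.2 e1)) (rnorm_ge0 (p.2 e2)).
move: (rnorm_ge0 (p.1 x)) (rnorm_ge0 (p.1 z)) (rnorm_ge0 (u p0)).
move=> g1 g2 g3 g4 g5 g6.
have q1 :
    rnorm (u p0) * (rnorm (p.1 one) * (2^-1 * rnorm (p.2 e2))) <=
    2^-1 * rnorm (p.2 e2).
  rewrite mulrA ler_piMl ?mulr_ge0//; nra.
have q2 : rnorm (p.1 x) * rnorm (p.2 e1) <= (1 + 200%:R^-1) * rnorm (p.2 e1).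
  by rewrite ler_wpM2r//; lra.
(* By [c1] and [xge], ||x|| > 99/100, so [zle] gives ||z|| < 39/100. *)
have q3 : rnorm (p.1 z) * rnorm (p.2 e2) <= 41%:R / 100%:R * rnorm (p.2 e2).
  by rewrite ler_wpM2r//; lra.
(* With A, B the moduli of p.2 at [e1], [e2], the total is at most 1/200 + (1 + 1/200) A + (41/100 +
   1/2) B. Under A <= 1 and A + B <= 2 this is at most 1.92, reached at A = B = 1. *)
lra.
Qed.

End counterexample.

Theorem theorem4p2 (R : realType) :
  exists E : completeNormedModType R[i],
    has_dim 2 E /\ ~ Daugavet (inj_tensor (L1 R) E).
Proof.
exists (plane R); split; first exact: plane_dim.
exact: tensor_plane_not_Daugavet.
Qed.
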